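(* Let $\alpha \in \mathbb{R}$ with $0 < \alpha < 1$ be an algebraic number such that the additive monoid $\mathbb{N}_0[\alpha]$ is atomic. Then $\mathbb{N}_0[\alpha]$ is an anti-prime monoid; that is, $\omega(a) = \infty$ for every atom $a$ of $\mathbb{N}_0[\alpha]$.
   Context: $\mathbb{N}$ and $\mathbb{N}_0$ denote the positive and the nonnegative integers. Algebraic numbers are algebraic over $\mathbb{Q}$. For a positive real $\alpha$, $\mathbb{N}_0[\alpha] := \{f(\alpha) \mid f(X) \in \mathbb{N}_0[X]\}$, where $\mathbb{N}_0[X]$ is the set of polynomials with coefficients in $\mathbb{N}_0$; it is regarded as an additive submonoid of $\mathbb{R}_{\ge 0}$. Let $M$ be a cancellative commutative monoid, written additively, whose only invertible element is $0$. An atom of $M$ is a nonzero $a \in M$ such that $a = b + c$ with $b, c \in M$ implies $b = 0$ or $c = 0$; $\mathcal{A}(M)$ is the set of atoms. $M$ is atomic if every nonzero element is a finite sum of atoms. For $b, c \in M$, write $b \mid_M c$ if $c = b + b'$ for some $b' \in M$. For $M$ atomic and nontrivial, the omega-primality $\omega(a)$ of $a \in \mathcal{A}(M)$ is the smallest $n \in \mathbb{N} \cup \{\infty\}$ such that: whenever $a \mid_M \sum_{i=1}^k a_i$ for some $a_1, \dots, a_k \in \mathcal{A}(M)$, there exists $S \subseteq \{1, \dots, k\}$ with $|S| \le n$ such that $a \mid_M \sum_{i \in S} a_i$. $M$ is anti-prime if $\omega(a) = \infty$ for every $a \in \mathcal{A}(M)$. *)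

(* Defs.v *)
From HB Require Import structures.
From mathcomp Require Import all_boot all_order all_algebra.
From mathcomp Require Import boolp reals.

Set Implicit Arguments.
Unset Strict Implicit.
Unset Printing Implicit Defensive.

Import Order.TTheory GRing.Theory Num.Theory.
Local Open Scope ring_scope.

Section AtomicMonoids.
Variable M : nmodType.

(* In this form the definition is only meaningful when 0 is the only
   invertible element of M. *)
Definition atom (a : M) : Prop :=
  a != 0 /\ forall b c : M, a = b + c -> b = 0 \/ c = 0.

Definition atomic : Prop :=
  forall x : M, x != 0 ->
    exists k (a : 'I_k -> M), (forall i, atom (a i)) /\ x = \sum_(i < k) a i.

Definition mdvd (b c : M) : Prop := exists b' : M, c = b + b'.

Definition omega_bound (a : M) (n : nat) : Prop :=
  forall k (b : 'I_k -> M), (forall i, atom (b i)) ->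
    mdvd a (\sum_(i < k) b i) ->
    exists S : {set 'I_k}, (#|S| <= n)%N /\ mdvd a (\sum_(i in S) b i).

(* An element of {1, 2, ...} with infinity adjoined: None stands for infinity,
   for which the bound on #|S| is vacuous. *)
Definition omega (a : M) : option nat :=
  if pselect (exists n, `[< (0 < n)%N /\ omega_bound a n >]) is left ex_n
  then Some (ex_minn ex_n) else None.

Definition anti_prime : Prop := forall a : M, atom a -> omega a = None.

End AtomicMonoids.

Arguments atomic : clear implicits.
Arguments anti_prime : clear implicits.

Section NatAdjoin.
Variables (R : realType) (alpha : R).

Definition in_nat_adjoin : {pred R} := fun x =>
  `[< exists f : {poly nat}, x = (map_poly (fun n : nat => n%:R) f).[alpha] >].

Lemma nmod_closed_nat_adjoin : Algebra.nmod_closed in_nat_adjoin.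
Proof.
split=> [|x y /asboolP[f ->] /asboolP[g ->]]; apply/asboolP.
  by exists 0; rewrite map_poly0 horner0.
exists (f + g); rewrite -hornerD; congr (_.[_]); apply/polyP => i.
by rewrite coefD !coef_map_id0// coefD natrD.
Qed.

HB.instance Definition _ :=
  Algebra.isAddClosed.Build R in_nat_adjoin nmod_closed_nat_adjoin.

Record nat_adjoin := NatAdjoin {
  nat_adjoin_val : R;
  _ : nat_adjoin_val \in in_nat_adjoin
}.

HB.instance Definition _ := [isSub for nat_adjoin_val].
HB.instance Definition _ := [Choice of nat_adjoin by <:].
HB.instance Definition _ :=
  GRing.SubChoice_isSubNmodule.Build R in_nat_adjoin nat_adjoin
    nmod_closed_nat_adjoin.

End NatAdjoin.

(* Main.v *)
Require Import Defs.
From HB Require Import structures.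
From mathcomp Require Import all_boot all_order all_algebra.
From mathcomp Require Import boolp reals.
From mathcomp Require Import ring lra.

Import Order.TTheory GRing.Theory Num.Theory.
Local Open Scope ring_scope.

(** Write M for N_0[alpha].  Let f be an integer polynomial with f(alpha) = 0
    and f(0) <> 0.  Splitting off its constant term shows that alpha divides
    the nonzero integer f(0) in Z[alpha]; taking an even N-th power and
    separating positive from negative coefficients gives, for every N, a
    positive integer c and u, v in M with
      c + alpha^N v = alpha^N u             (lemma [natr_split_expr]).
    Multiply by an atom a: as c a = a + (c - 1) a, the atom a divides the
    element alpha^N (a u) of M.  That element is a sum of powers alpha^j with
    j >= N, and each of them is, by atomicity, a sum of atoms, none of which
    exceeds alpha^j <= alpha^N as real numbers (lemma [sum_small_atoms]).  So
    a divides a sum of atoms of size at most alpha^N, whereas a subsum of at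
    most n of these is at most n alpha^N.  Since alpha < 1, this is smaller
    than a for N large, so that a cannot divide such a subsum; hence no finite
    n bounds omega(a). *)

(** The powers of a number in ]0, 1[ tend to 0, made effective by the
    Bernoulli-type bound alpha^N (1 + N (1 - alpha)) <= 1. *)
Lemma natr_mul_expr_lt (R : archiRealFieldType) (alpha e : R) (n : nat) :
  0 < alpha -> alpha < 1 -> 0 < e -> exists N, n%:R * alpha ^+ N < e.
Proof.
move=> a0 a1 e0; have d0 : 0 < 1 - alpha by lra.
have bern k : alpha ^+ k * (1 + k%:R * (1 - alpha)) <= 1.
  elim: k => [|k IH]; first by rewrite expr0; lra.
  apply: le_trans IH; rewrite exprSr -mulrA ler_pM2l ?exprn_gt0// -natr1.
  have : 0 <= (k%:R + 1) * (1 - alpha) ^+ 2.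
    by rewrite mulr_ge0 ?sqr_ge0 ?addr_ge0.
  lra.
pose x := n%:R / ((1 - alpha) * e).
have x0 : 0 <= x by rewrite divr_ge0// mulr_ge0// ltW.
exists (Num.bound x); move: (bern (Num.bound x)) (archi_boundP x0).
rewrite /x ltr_pdivrMr ?mulr_gt0//; set N := Num.bound _ => bN nN.
have p0 : 0 < alpha ^+ N by rewrite exprn_gt0.
have : n%:R * alpha ^+ N < N%:R * ((1 - alpha) * e) * alpha ^+ N.
  by rewrite ltr_pM2r.
move=> /lt_le_trans; apply.
have : e * (alpha ^+ N * (1 + N%:R * (1 - alpha))) <= e * 1 by rewrite ler_pM2l.
by have := mulr_gt0 e0 p0; lra.
Qed.

Section NatAdjoinTheory.
Variables (R : realType) (alpha : R).

Local Notation M := (nat_adjoin alpha).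
Local Notation S := (in_nat_adjoin alpha).

Lemma mulr_closed_nat_adjoin : mulr_closed S.
Proof.
split=> [|x y /asboolP[f ->] /asboolP[g ->]]; apply/asboolP.
  by exists 1; rewrite rmorph1 hornerC.
by exists (f * g); rewrite rmorphM hornerM.
Qed.

HB.instance Definition _ :=
  GRing.isMulClosed.Build R S mulr_closed_nat_adjoin.

Lemma gen_nat_adjoin : alpha \in S.
Proof. by apply/asboolP; exists 'X; rewrite map_polyX hornerX. Qed.

Lemma nat_adjoin_ge0 (x : R) : 0 <= alpha -> x \in S -> 0 <= x.
Proof.
move=> a0 /asboolP[f ->]; rewrite horner_coef sumr_ge0// => i _.
by rewrite coef_map mulr_ge0// exprn_ge0.
Qed.

(** The positive and the negative coefficients of q give u and v. *)
Lemma horner_int_split (q : {poly int}) :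
  exists u v, [/\ u \in S, v \in S & (map_poly intr q).[alpha] = u - v].
Proof.
elim/poly_ind: q => [|q c [u [v [uS vS E]]]].
  by exists 0, 0; rewrite rmorph0 horner0 subrr !rpred0.
have [s [t [sS tS Ec]]] :
    exists s t, [/\ s \in S, t \in S & c%:~R = s - t :> R].
  case: c => n; first by exists n%:R, 0; rewrite subr0 rpred_nat rpred0.
  by exists 0, n.+1%:R; rewrite sub0r rpred_nat rpred0 NegzE rmorphN.
exists (u * alpha + s), (v * alpha + t).
rewrite !rpredD ?rpredM ?gen_nat_adjoin//; split=> //.
by rewrite rmorphD rmorphM /= map_polyX map_polyC !hornerE /= E Ec; ring.
Qed.

(** A rational polynomial vanishing at alpha yields, after clearing
    denominators and removing the factors X, an integer one with nonzero
    constant term. *)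
Lemma algebraic_int_poly :
  alpha != 0 -> algebraicOver (ratr : rat -> R) alpha ->
  exists2 q : {poly int}, q.[0] != 0 & (map_poly intr q).[alpha] = 0.
Proof.
move=> a0 [p p0 pa]; have [q [d d0 pq]] := rat_poly_scale p.
have q0 : q != 0.
  by apply: contraNneq p0 => q0; rewrite pq q0 rmorph0 scaler0.
have qa : (map_poly intr q).[alpha] = 0 :> R.
  move: pa; rewrite pq linearZ /= /root hornerZ mulf_eq0 fmorph_eq0 invr_eq0.
  rewrite intr_eq0 (negPf d0) /= -map_poly_comp => /eqP <-.
  by congr horner; apply: eq_map_poly => i; rewrite /= rmorph_int.
have [m [r]] := multiplicity_XsubC q 0; rewrite q0 /= => r0 qr.
exists r => //; move: qa; rewrite qr subr0 rmorphM rmorphXn /= map_polyX.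
move=> /eqP; rewrite hornerM hornerXn mulf_eq0 expf_eq0 (negPf a0) andbF orbF.
by move/eqP.
Qed.

(** If q = r X + c vanishes at alpha, then c = - r(alpha) alpha, so that a high
    power of c is divisible in Z[alpha] by a high power of alpha.  Read in
    N_0[alpha], this says that 1 divides an element of alpha^N N_0[alpha]. *)
Lemma natr_split_expr (N : nat) :
  alpha != 0 -> algebraicOver (ratr : rat -> R) alpha ->
  exists c u v, [/\ u \in S, v \in S &
    c.+1%:R + alpha ^+ N * v = alpha ^+ N * u].
Proof.
move=> a0 /(algebraic_int_poly a0)[q q0 qa].
have [r [c]] : exists r c, q = r * 'X + c%:P.
  by elim/poly_ind: q {q0 qa} => [|r c _]; [exists 0, 0 | exists r, c];
    rewrite ?mul0r ?addr0.
move=> qr; move: q0 qa; rewrite qr !hornerE => c0.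
rewrite rmorphD rmorphM /= map_polyX map_polyC !hornerE /= => qa.
(* The exponent N.*2 rather than N makes the power of the constant term
   positive. *)
have E : c%:~R ^+ N.*2 =
    alpha ^+ N * (map_poly intr (r ^+ N.*2 * 'X^N)).[alpha] :> R.
  have -> : c%:~R = - (map_poly intr r).[alpha] * alpha :> R.
    by rewrite mulNr; apply/eqP; rewrite -addr_eq0 addrC qa.
  rewrite rmorphM !rmorphXn /= map_polyX hornerM horner_exp hornerXn.
  rewrite exprMn exprNn -signr_odd odd_double mul1r -addnn !exprD; ring.
have [u [v [uS vS uv]]] := horner_int_split (r ^+ N.*2 * 'X^N).
exists (`|c| ^ N.*2).-1%N, u, v; split=> //.
rewrite prednK ?expn_gt0 ?absz_gt0 ?c0// natrX natr_absz.
have -> : `|c|%:~R ^+ N.*2 = c%:~R ^+ N.*2 :> R.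
  by rewrite -mul2n !exprM intr_norm real_normK ?num_real.
by rewrite E uv; ring.
Qed.

Lemma val_nat_adjoin_sum (I : Type) (s : seq I) (P : pred I) (F : I -> M) :
  val (\sum_(i <- s | P i) F i) = \sum_(i <- s | P i) val (F i).
Proof. exact: raddf_sum. Qed.

(** The element is a sum of powers alpha^j with j >= N.  Atomicity splits each
    of them into atoms, and a summand of an element of M does not exceed it, so
    these atoms are at most alpha^j <= alpha^N. *)
Lemma sum_small_atoms (N : nat) (x : M) (y : R) :
  0 < alpha -> alpha < 1 -> atomic M ->
  y \in S -> val x = alpha ^+ N * y ->
  exists k (b : 'I_k -> M),
    (forall i, atom (b i) /\ val (b i) <= alpha ^+ N) /\ x = \sum_(i < k) b i.
Proof.
move=> a0 a1 atomicM.
pose small (z : M) := exists s : seq M,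
  {in s, forall w, atom w /\ val w <= alpha ^+ N} /\ z = \sum_(w <- s) w.
have smallD z t : small z -> small t -> small (z + t).
  move=> [s [sP ->]] [s' [s'P ->]]; exists (s ++ s').
  rewrite big_cat; split=> //.
  by move=> w; rewrite mem_cat => /orP[/sP|/s'P].
have small0 : small 0 by exists [::]; rewrite big_nil.
have smallX j : (N <= j)%N -> forall z : M, val z = alpha ^+ j -> small z.
  move=> Nj z zE; have z0 : z != 0.
    by apply: contraTneq (exprn_gt0 j a0) => z0; rewrite -zE z0 /= ltxx.
  have [k [b [bA zb]]] := atomicM z z0.
  exists [seq b i | i <- enum 'I_k]; rewrite big_map big_enum; split=> //.
  move=> _ /mapP[i _ ->]; split=> //.
  have : val (b i) <= val z.
    rewrite zb val_nat_adjoin_sum (bigD1 i)//= lerDl sumr_ge0// => l _.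
    exact: nat_adjoin_ge0 (ltW a0) (valP (b l)).
  move/le_trans; apply; rewrite zE.
  by apply: ler_wiXn2l => //; exact: ltW.
move=> /asboolP[f ->] xE.
pose m i : M := Sub (alpha ^+ i) (rpredX i gen_nat_adjoin).
have -> : x = \sum_(i < size f) m (N + i)%N *+ (f`_i)%R.
  apply: val_inj; rewrite xE val_nat_adjoin_sum.
  rewrite (horner_coef_wide _ (size_poly _ _)) mulr_sumr; apply: eq_bigr => i _.
  by rewrite raddfMn /= exprD coef_map /= mulrCA mulr_natl.
have [s [sP ->]] : small (\sum_(i < size f) m (N + i)%N *+ (f`_i)%R).
  elim/big_rec: _ => // i z _; apply: (smallD).
  elim: (f`_i) => [|n IH]; rewrite ?mulr0n ?mulrS//; apply: (smallD) => //.
  exact: (smallX _ (leq_addr i N)).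
exists (size s), (tnth (in_tuple s)); split; last by rewrite big_tnth.
by move=> i; apply: sP; exact: mem_tnth.
Qed.

End NatAdjoinTheory.

Theorem theorem3p1 (R : realType) (alpha : R)
  (alpha_gt0 : 0 < alpha) (alpha_lt1 : alpha < 1)
  (alpha_alg : algebraicOver (ratr : rat -> R) alpha)
  (atomic_alpha : atomic (nat_adjoin alpha)) :
  anti_prime (nat_adjoin alpha).
Proof.
move=> a [a0 _]; rewrite /omega.
case: pselect => // ex_n; exfalso; case: ex_n => n /asboolP[_ bound_n].
have val_ge0 (z : nat_adjoin alpha) : 0 <= val z.
  exact: nat_adjoin_ge0 (ltW alpha_gt0) (valP z).
have a_gt0 : 0 < val a.
  rewrite lt_neqAle val_ge0 andbT eq_sym; apply: contra a0 => /eqP va.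
  by apply/eqP/val_inj.
have [N smallN] := natr_mul_expr_lt _ _ _ n alpha_gt0 alpha_lt1 a_gt0.
have [c [u [v [uS vS cuv]]]] :=
  natr_split_expr _ _ N (lt0r_neq0 alpha_gt0) alpha_alg.
have alphaNS := rpredX N (gen_nat_adjoin _ alpha).
have auS : val a * u \in in_nat_adjoin alpha by rewrite rpredM ?(valP a).
have avS : alpha ^+ N * (val a * v) \in in_nat_adjoin alpha.
  by rewrite !rpredM ?(valP a).
have xS : alpha ^+ N * (val a * u) \in in_nat_adjoin alpha by rewrite rpredM.
pose x : nat_adjoin alpha := NatAdjoin xS.
pose y : nat_adjoin alpha := NatAdjoin avS.
have xE : x = a + (a *+ c + y).
  apply: val_inj; rewrite !raddfD raddfMn /= mulrCA -cuv -natr1 -mulr_natl.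
  ring.
have [k [b [bP xb]]] :=
  sum_small_atoms _ _ N x _ alpha_gt0 alpha_lt1 atomic_alpha auS erefl.
have [|T [Tn [z bT]]] := bound_n k b (fun i => proj1 (bP i)).
  by exists (a *+ c + y); rewrite -xb.
suff : val a < val a by rewrite ltxx.
have : val a <= val (\sum_(i in T) b i).
  by rewrite bT raddfD lerDl val_ge0.
move=> /le_lt_trans; apply; apply: le_lt_trans smallN.
rewrite val_nat_adjoin_sum; apply: le_trans (_ : \sum_(i in T) alpha ^+ N <= _).
  by apply: ler_sum => i _; case: (bP i).
by rewrite sumr_const -[_ *+ #|_|]mulr_natl ler_pM2r ?exprn_gt0// ler_nat.
Qed.
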